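(* Let $U$ be a finite set and $\mathcal{O}\subseteq\mathcal{P}(U)$ a set of obligations (not assumed independent), and let $X\subseteq U$. Then: (1.1) If $X\prec_{l,s}U\setminus X$, then $X$ is $\preceq_s$-closed. (1.2) If $X\prec_{l,s}U\setminus X$, then $X$ contains all best elements of $U$. (2.1) If $X$ is (ui), then $X$ is $\preceq_s$-closed. (2.2) $X$ being (ui) does not necessarily imply that $X$ contains all $\preceq_s$-best elements of $U$. (3.1) If $X\in\mathcal{D}(\mathcal{O})$, then $X$ is $\preceq_s$-closed. (3.2) If $X\in\mathcal{D}(\mathcal{O})$, then $X$ contains all $\preceq_s$-best elements of $U$. (4.1) If $X$ is an improving neighbourhood of the set of $\preceq_s$-best elements of $U$, then $X$ is $\preceq_s$-closed. (4.2) If $X$ is an improving neighbourhood of the set of best elements of $U$, then $X$ contains all best elements of $U$.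
   Context: $U$ is a finite set (the set of situations under consideration), and $\mathcal{O}\subseteq\mathcal{P}(U)$ is a set of ''obligations''. For $x,y\in U$: - $\mathcal{O}(x):=\{O\in\mathcal{O}: x\in O\}$. - Quality (set variant; smaller means better): $x\preceq_s y$ iff $\mathcal{O}(y)\subseteq\mathcal{O}(x)$; $x\prec_s y$ iff $\mathcal{O}(y)\subsetneq\mathcal{O}(x)$. - Distance (set variant): $d_s(x,y):=\mathcal{O}(x)\,\triangle\,\mathcal{O}(y)$ (symmetric difference); distances are compared by inclusion. - $[x,z]_s:=\{y\in U: d_s(x,z)=d_s(x,y)\cup d_s(y,z)\}$. - A best ($\preceq_s$-best) element of $U$ is some $x\in U$ such that there is no $z\in U$ with $z\prec_s x$. - $X\subseteq U$ is $\preceq_s$-closed iff for all $x\in X$, $y\in U$: $y\preceq_s x$ implies $y\in X$. - An element $x'$ of a set $Y$ is closest to $x$ in $Y$ iff there is no $x''\in Y$ with $d_s(x,x'')\subsetneq d_s(x,x')$. Let $x\parallel Y$ be the set of elements of $Y$ closest to $x$. - $X\prec_{l,s}Y$ iff for all $x\in X$ and all $y\in x\parallel Y$ we have $x\prec_s y$, and for all $y\in Y$ and all $x\in y\parallel X$ we have $x\prec_s y$. - $X$ is (ui) (union of intersections) iff there is a family $(\mathcal{O}_i)_{i\in I}$ with $\mathcal{O}_i\subseteq\mathcal{O}$ and $X=\bigcup_{i\in I}\bigcap\mathcal{O}_i$, where $\bigcap\emptyset:=U$. - For $\mathcal{O}'\subseteq\mathcal{O}$, $\delta:\mathcal{O}'\to\{0,1\}$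 and $m\in U$, $m\models\delta$ iff for all $O\in\mathcal{O}'$: $m\in O\Leftrightarrow\delta(O)=1$. - $X\in\mathcal{D}(\mathcal{O})$ iff for all $\mathcal{O}'\subseteq\mathcal{O}$, all $\delta:\mathcal{O}'\to\{0,1\}$ and all $m,m'\in U$ with $m,m'\models\delta$, $m\in X$, $m'\notin X$, there is $m''\in X$ with $m''\models\delta$ and $m''\prec_s m'$. - For $B\subseteq Y\subseteq U$: $Y$ is an improving neighbourhood of $B$ in $U$ iff for all $y\in Y$ and all $x$ that are closest to $y$ in $\{x'\in B: x'\preceq_s y\}$, $[x,y]_s\subseteq Y$. (The notion requires $B\subseteq Y$.)
   Formalization: Parts (1.2) and (3.2) are proved for nonempty X only: for X empty and U nonempty their hypotheses hold vacuously, yet U has best elements, so both claims fail. The example in (2.2) is also required to have X nonempty, which is stronger. *)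

(* Defs.v *)
From mathcomp Require Import all_boot.

Set Implicit Arguments.
Unset Strict Implicit.
Unset Printing Implicit Defensive.

Section Obligations.

Variables (U : finType) (O : {set {set U}}).

Implicit Types (x y z : U) (X Y B : {set U}).

Definition obl x : {set {set U}} := [set A in O | x \in A].

(* Smaller means better: a better point satisfies more obligations. *)
Definition qle x y : bool := obl y \subset obl x.
Definition qlt x y : bool := obl y \proper obl x.

Definition symdiff (T : finType) (A B : {set T}) : {set T} :=
  (A :\: B) :|: (B :\: A).

Definition dist x y : {set {set U}} := symdiff (obl x) (obl y).

Definition between x z : {set U} :=
  [set y | dist x z == dist x y :|: dist y z].

Definition best : {set U} := [set x | ~~ [exists z, qlt z x]].

Definition qclosed X : Prop :=
  forall x y, x \in X -> qle y x -> y \in X.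

(* The elements of Y closest to x, written x || Y; distances are sets of
   obligations, compared by inclusion. *)
Definition closest x Y : {set U} :=
  [set y in Y | ~~ [exists z in Y, dist x z \proper dist x y]].

Definition local_lt X Y : Prop :=
  (forall x y, x \in X -> y \in closest x Y -> qlt x y) /\
  (forall y x, y \in Y -> x \in closest y X -> qlt x y).

(* Union of intersections, over an arbitrary index type.  In finset the
   intersection over the empty family is setT, matching the convention that
   it is the whole of U. *)
Definition ui X : Prop :=
  exists (I : Type) (Oi : I -> {set {set U}}),
    (forall i, Oi i \subset O) /\
    (forall x, x \in X <-> exists i, x \in \bigcap_(A in Oi i) A).

(* m |= delta, for delta : O' -> {0,1}.  A partial map with domain O' is
   encoded as a total one of which only the values on O' are used. *)
Definition models (O' : {set {set U}}) (delta : {set U} -> bool) (m : U) : Prop :=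
  forall A, A \in O' -> (m \in A <-> delta A = true).

Definition in_D X : Prop :=
  forall (O' : {set {set U}}) (delta : {set U} -> bool) (m m' : U),
    O' \subset O ->
    models O' delta m -> models O' delta m' ->
    m \in X -> m' \notin X ->
    exists2 m'' : U, m'' \in X & models O' delta m'' /\ qlt m'' m'.

Definition improving_nbhd B Y : Prop :=
  B \subset Y /\
  forall y x, y \in Y -> x \in closest y [set x' in B | qle x' y] ->
    between x y \subset Y.

End Obligations.

(* Main.v *)
Require Import Defs.
From mathcomp Require Import all_boot.

(** Since [d(x, y) = O(y) \ O(x)] whenever [y] is at least as good as [x],
    anything strictly closer to [x] than such a [y] lies between them in
    quality.  Hence in a minimal violation of closedness [y] is closest to [x]
    outside [X], and every best element at least as good as [y] is closest to
    [x] among the best elements.  For sets in [D(O)], freezing the obligations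
    that hold at [x] or fail at [y] leaves no room for an improvement of [y]. *)

Lemma in_dist (U : finType) (O : {set {set U}}) (x y : U) (A : {set U}) :
  (A \in dist O x y) = (A \in obl O x) (+) (A \in obl O y).
Proof. by rewrite !in_setU !in_setD; case: (_ \in _); case: (_ \in _). Qed.

Lemma proper_dist_between (U : finType) (O : {set {set U}}) (x y z : U) :
  qle O y x -> dist O x z \proper dist O x y -> qle O z x /\ qlt O y z.
Proof.
move=> /subsetP yx /properP[/subsetP zy [A Ay Az]].
move: Ay Az; rewrite !in_dist => Ay Az.
split; first (apply/subsetP=> B Bx); last apply/properP; last split.
- move: (zy B); rewrite !in_dist Bx (yx _ Bx) /=.
  by case: (B \in _) => // /(_ isT).
- apply/subsetP=> B Bz; move: (zy B) (yx B); rewrite !in_dist Bz.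
  by case: (B \in obl O x) => /= [_ ->|->].
- exists A; move: (yx A) Ay Az; rewrite ?in_dist;
    case: (A \in obl O x); case: (A \in obl O y); case: (A \in obl O z) => //=;
    by move=> /(_ isT).
Qed.

(** Along a chain of decreasing quality the distance is a plain difference, and
    [obl O x :\: obl O z] splits at [obl O y]. *)
Lemma qle_between (U : finType) (O : {set {set U}}) (x y z : U) :
  qle O x y -> qle O y z -> y \in between O x z.
Proof.
move=> /subsetP xy /subsetP yz; rewrite inE; apply/eqP/setP=> A.
rewrite in_setU !in_dist; move: (xy A) (yz A).
case: (A \in obl O x); case: (A \in obl O y); case: (A \in obl O z) => //=;
  by [move=> /(_ isT) | move=> _ /(_ isT)].
Qed.

Lemma bestPn (U : finType) (O : {set {set U}}) (x z : U) :
  x \in best O -> ~~ qlt O z x.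
Proof. by rewrite inE negb_exists => /forallP. Qed.

Lemma exists_best_qle (U : finType) (O : {set {set U}}) (x : U) :
  exists2 b, b \in best O & qle O b x.
Proof.
have xx : qle O x x by exact: subxx.
(* A strict improvement of [b] would still be at least as good as [x] and satisfy more obligations
   than the maximum. *)
case: (@arg_maxnP U x (fun b => qle O b x) (fun b => #|obl O b|) xx) => b bx bmax.
exists b => //; rewrite inE; apply/existsPn=> z; apply/negP=> zb.
have := bmax z (subset_trans bx (proper_sub zb)).
by rewrite /= leqNgt (proper_card zb).
Qed.

Lemma exists_closest (U : finType) (O : {set {set U}}) (x : U) (Y : {set U}) :
  Y != set0 -> exists y, y \in closest O x Y.
Proof.
case/set0Pn=> y0 y0Y.
case: (@arg_minnP U y0 (fun y => y \in Y) (fun y => #|dist O x y|) y0Y) => y yY ymin.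
exists y; rewrite inE yY; apply/existsPn=> z; apply/negP=> /andP[zY zy].
by have := ymin z zY; rewrite /= leqNgt (proper_card zy).
Qed.

Lemma local_lt_qclosed (U : finType) (O : {set {set U}}) (X : {set U}) :
  local_lt O X (~: X) -> qclosed O X.
Proof.
move=> [XltC _] x y0 xX y0x; apply/negPn/negP=> y0X.
have y0P : (y0 \notin X) && qle O y0 x by rewrite y0X.
(* Among the violations take one satisfying the fewest obligations: a point outside [X] closer to
   [x] would be a violation with fewer still. *)
case: (@arg_minnP U y0 (fun y => (y \notin X) && qle O y x)
         (fun y => #|obl O y|) y0P) => y /andP[yX yx] ymin.
have yC : y \in closest O x (~: X).
  rewrite inE in_setC yX; apply/existsPn=> z; rewrite in_setC.
  apply/negP=> /andP[zX /(proper_dist_between _ _ _ _ _ yx)[zx yz]].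
  by have := ymin z; rewrite /= zX zx leqNgt (proper_card yz) => /(_ isT).
by have := XltC x y xX yC; rewrite /qlt properE => /andP[_ /negP].
Qed.

(** A point outside [X] is strictly improved by any element of [X] closest to it. Such an element
    exists only for nonempty [X]; for empty [X], [local_lt] holds vacuously. *)
Lemma local_lt_best (U : finType) (O : {set {set U}}) (X : {set U}) :
  X != set0 -> local_lt O X (~: X) -> best O \subset X.
Proof.
move=> X0 [_ CltX]; apply/subsetP=> y yb; apply/negPn/negP=> yX.
have [x xC] := exists_closest _ O y _ X0.
have := bestPn _ _ _ x yb; rewrite (CltX y) //.
by rewrite in_setC.
Qed.

(** Improving a point loses no obligation of [O], so the point stays in each intersection that
    contains it. *)
Lemma ui_qclosed (U : finType) (O : {set {set U}}) (X : {set U}) :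
  ui O X -> qclosed O X.
Proof.
move=> [I [Oi [OiO XE]]] x y /XE[i /bigcapP xi] /subsetP yx.
apply/XE; exists i; apply/bigcapP=> A Ai.
have : A \in obl O x by rewrite inE (subsetP (OiO i)) ?xi.
by move/yx; rewrite inE => /andP[].
Qed.

Lemma ui_not_best :
  exists (U : finType) (O : {set {set U}}) (X : {set U}),
    X != set0 /\ ui O X /\ ~~ (best O \subset X).
Proof.
(* Two incomparable points, each satisfying its own singleton obligation, are both best, but the
   intersection of one obligation contains only one of them. *)
pose O : {set {set bool}} := [set [set true]; [set false]].
exists bool, O, [set true]; split; first by apply/set0Pn; exists true; rewrite inE.
split.
  exists unit, (fun=> [set [set true]]); split=> [_|x].
    by rewrite sub1set !inE eqxx.
  by split=> [xt|[_]]; [exists tt|]; rewrite big_set1.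
apply/subsetPn; exists false; last by rewrite inE.
rewrite inE; apply/existsPn=> z; apply/negP=> /properP[/subsetP fz [A]].
have : [set false] \in obl O z by apply: fz; rewrite !inE eqxx orbT.
by rewrite {1}/obl in_set in_set1 => /andP[_ /eqP<-] ->.
Qed.

Lemma in_D_qclosed (U : finType) (O : {set {set U}}) (X : {set U}) :
  in_D O X -> qclosed O X.
Proof.
move=> XD x y xX /subsetP yx; apply/negPn/negP=> yX.
pose O' := obl O x :|: (O :\: obl O y).
have O'O : O' \subset O.
  by apply/subsetP=> A; rewrite !inE => /orP[/andP[]|/andP[]].
have xy A : A \in O' -> (x \in A) = (y \in A).
  move: (yx A); rewrite !inE; case: (A \in O) => //=.
  by case: (x \in A) => [/(_ isT) ->|_ /andP[/negbTE->]].
have [||//|z zX [zO' /properP[_ [A Az Ay]]]] :=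
  XD O' (fun A => x \in A) x y O'O _ _ xX.
- by move=> A.
- by move=> A AO'; rewrite xy.
(* The obligation [A] gained by [z] fails at [y], hence is frozen: [z] agrees on it with [x] and so
   with [y]. *)
move: Az; rewrite inE => /andP[AO zA].
have AO' : A \in O' by rewrite in_setU in_setD Ay AO orbT.
have /(zO' A AO') := zA; rewrite xy // => yA.
by move: Ay; rewrite inE AO yA.
Qed.

Lemma in_D_best (U : finType) (O : {set {set U}}) (X : {set U}) :
  X != set0 -> in_D O X -> best O \subset X.
Proof.
case/set0Pn=> x xX XD; apply/subsetP=> y yb; apply/negPn/negP=> yX.
(* Over the empty set of obligations any two points model the same assignment, so one element of [X]
   forces an improvement of every point outside [X]. *)
have no_constraint (m : U) : models set0 (fun=> true) m by move=> A; rewrite inE.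
have [z _ [_ zy]] := XD _ _ x y (sub0set _) (no_constraint x)
  (no_constraint y) xX yX.
by move: (bestPn _ _ _ z yb); rewrite zy.
Qed.

Lemma improving_nbhd_best_qclosed
    (U : finType) (O : {set {set U}}) (X : {set U}) :
  improving_nbhd O (best O) X -> qclosed O X.
Proof.
move=> [_ Xnb] x y xX yx; have [b bb ble] := exists_best_qle _ O y.
have bx : qle O b x := subset_trans yx ble.
apply: (subsetP (Xnb x b xX _)); last exact: qle_between.
have bC : b \in [set b' in best O | qle O b' x] by rewrite in_set bb bx.
(* A best [z] closer to [x] than [b] would be strictly worse than [b], contradicting that [z] is
   best. *)
rewrite in_set bC; apply/existsPn=> z; rewrite in_set.
apply/negP=> /andP[/andP[zb _] /(proper_dist_between _ _ _ _ _ bx)[_ bz]].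
by move: (bestPn _ _ _ b zb); rewrite bz.
Qed.

Theorem fact4p2 (U : finType) (O : {set {set U}}) (X : {set U}) :
  (local_lt O X (~: X) -> qclosed O X) /\
  (X != set0 -> local_lt O X (~: X) -> best O \subset X) /\
  (ui O X -> qclosed O X) /\
  (exists (U0 : finType) (O0 : {set {set U0}}) (X0 : {set U0}),
     X0 != set0 /\ ui O0 X0 /\ ~~ (best O0 \subset X0)) /\
  (in_D O X -> qclosed O X) /\
  (X != set0 -> in_D O X -> best O \subset X) /\
  (improving_nbhd O (best O) X -> qclosed O X) /\
  (improving_nbhd O (best O) X -> best O \subset X).
Proof.
split; first exact: local_lt_qclosed.
split; first exact: local_lt_best.
split; first exact: ui_qclosed.
split; first exact: ui_not_best.
split; first exact: in_D_qclosed.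
split; first exact: in_D_best.
by split=> [|[]//]; exact: improving_nbhd_best_qclosed.
Qed.
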